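(* Let $(\alpha^*,\pi^* )$ be the true parameter of the stochastic block model and assume (A1), (A2), (A3) (see context) hold for $(\alpha^*,\pi^* )$ and for all parameters $(\alpha,\pi)$ considered. Let $$(\widehat\alpha,\widehat\pi)=\operatorname{argmax}_{(\alpha,\pi)}\mathcal{L}_2(X_{[n]};\alpha,\pi)$$ be the maximum-likelihood estimator of $(\alpha^*,\pi^* )$, the maximum being over parameters satisfying (A1), (A2), (A3). Then for any distance $d$ on the set of parameters $\pi$ (considered up to label switching, see context), $$d(\widehat\pi,\pi^* )\xrightarrow[n\to+\infty]{\mathbb{P}}0 .$$
   Context: Stochastic block model (SBM): $Q$ is fixed and known. With parameters $(\alpha,\pi)$, where $\alpha$ is a probability vector in $(0,1)^Q$ and $\pi\in[0,1]^{Q\times Q}$, the labels $Z=(Z_i)_{i\geq1}$ are i.i.d. with $\mathbb{P}(Z_i=q)=\alpha_q$; given $Z$, the $X_{i,j}$, $i\neq j$, are independent Bernoulli$(\pi_{Z_i,Z_j})$, and $X_{i,i}=0$. $X_{[n]}=(X_{i,j})_{1\leq i,j\leq n}$. $\mathbb{P}$ is the law under $(\alpha^*,\pi^* )$ and $\xrightarrow{\mathbb{P}}$ is convergence in probability. Log-likelihoods: $\mathcal{L}_1(X_{[n]};z_{[n]},\pi)=\sum_{i\neq j}\{X_{i,j}\log\pi_{z_i,z_j}+(1-X_{i,j})\log(1-\pi_{z_i,z_j})\}$ for $z_{[n]}\in\{1,\ldots,Q\}^n$, and $\mathcal{L}_2(X_{[n]};\alpha,\pi)=\log\left(\sum_{z_{[n]}}e^{\mathcal{L}_1(X_{[n]};z_{[n]},\pi)}\prod_{i=1}^n\alpha_{z_i}\right)$.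 Conventions: $0\log0=0$, $e^{-\infty}=0$, $\log0=-\infty$. A maximizer is assumed to exist. Distance up to label switching: $d(\pi,\pi^* )=\min_\sigma d_0(\pi^\sigma,\pi^* )$, minimum over permutations $\sigma$ of $\{1,\ldots,Q\}$, with $\pi^\sigma_{q,l}=\pi_{\sigma(q),\sigma(l)}$ and $d_0$ a distance on $\mathbb{R}^{Q\times Q}$ inducing the usual topology. (A1) for every $q\neq q'$ there is $l$ with $\pi_{q,l}\neq\pi_{q',l}$ or $\pi_{l,q}\neq\pi_{l,q'}$. (A2) for all $(q,l)$, $\pi_{q,l}\in(0,1)$ implies $\pi_{q,l}\in[\zeta,1-\zeta]$, with $\zeta>0$ a fixed constant not depending on $n$. (A3) $\alpha_q\in[\gamma,1-\gamma]$ for all $q$, with $0<\gamma<1/Q$ a fixed constant not depending on $n$. *)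

(* Defs.v *)
From HB Require Import structures.
From mathcomp Require Import all_boot all_order all_algebra all_fingroup.
From mathcomp Require Import all_classical all_reals all_analysis.

Set Implicit Arguments.
Unset Strict Implicit.
Unset Printing Implicit Defensive.

Import Order.TTheory GRing.Theory Num.Theory.
Import numFieldNormedType.Exports.

Local Open Scope classical_set_scope.
Local Open Scope ring_scope.

(* Labels are elements of 'I_Q and vertices are numbered from 0. *)

Section Admissible.
Context {R : realType} {Q : nat}.
Implicit Types (alpha : 'I_Q -> R) (pi : 'M[R]_Q).

Definition sbm_param alpha pi : Prop :=
  [/\ forall q, 0 < alpha q < 1,
      \sum_q alpha q = 1
    & forall q l, 0 <= pi q l <= 1].

Definition A1 pi : Prop :=
  forall q q', q != q' ->
    exists l, pi q l != pi q' l \/ pi l q != pi l q'.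

Definition A2 (zeta : R) pi : Prop :=
  forall q l, 0 < pi q l < 1 -> zeta <= pi q l <= 1 - zeta.

Definition A3 (gamma : R) alpha : Prop :=
  forall q, gamma <= alpha q <= 1 - gamma.

Definition admissible (zeta gamma : R) alpha pi : Prop :=
  [/\ sbm_param alpha pi, A1 pi, A2 zeta pi & A3 gamma alpha].

End Admissible.

Section Model.
Context {R : realType} {Q : nat} {d : measure_display} {T : measurableType d}.
Context (P : probability T R).
Context (Z : nat -> T -> 'I_Q) (X : nat -> nat -> T -> bool).

Definition label_events : set (set T) :=
  [set A | exists i q, A = Z i @^-1` [set q]].

(* The labels being discrete, it is enough to ask for the product rule on the
   atoms [Z i = q]. *)
Definition iid_labels (alpha : 'I_Q -> R) : Prop :=
  [/\ forall i q, measurable (Z i @^-1` [set q]),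
      forall i q, P (Z i @^-1` [set q]) = (alpha q)%:E
    & forall (s : seq nat) (z : nat -> 'I_Q), uniq s ->
        P [set w | forall i, i \in s -> Z i w = z i] =
        (\prod_(i <- s) P (Z i @^-1` [set z i]))%E].

(* The last clause says that, for every finite family s of ordered pairs of
   distinct vertices, the conditional probability of [X = x on s] given the
   sigma-algebra generated by Z is almost surely the product of the Bernoulli
   weights. *)
Definition cond_bernoulli_edges (pi : 'M[R]_Q) : Prop :=
  [/\ forall i j, measurable_fun setT (X i j),
      forall i w, X i i w = false
    & forall (s : seq (nat * nat)) (x : nat -> nat -> bool) (A : set T),
        uniq s -> all (fun e => e.1 != e.2) s -> <<s label_events >> A ->
        P (A `&` [set w | forall i j, (i, j) \in s -> X i j w = x i j]) =
        (\int[P]_(w in A)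
          (\prod_(e <- s)
             bernoulli_pmf (pi (Z e.1 w) (Z e.2 w)) (x e.1 e.2))%:E)%E].

Definition is_sbm (alpha : 'I_Q -> R) (pi : 'M[R]_Q) : Prop :=
  iid_labels alpha /\ cond_bernoulli_edges pi.

Definition adjacency (n : nat) (w : T) : 'M[bool]_n :=
  \matrix_(i, j) X i j w.

End Model.

Section Likelihood.
Context {R : realType} {Q n : nat}.
Implicit Types (x : 'M[bool]_n) (z : {ffun 'I_n -> 'I_Q}).
Implicit Types (alpha : 'I_Q -> R) (pi : 'M[R]_Q).
Local Open Scope ereal_scope.

(* In \bar R one has lne 0 = -oo, expeR -oo = 0 and 0 * -oo = 0. *)
Definition L1 x z pi : \bar R :=
  \sum_(i < n) \sum_(j < n | i != j)
    ((x i j)%:R%:E * lne (pi (z i) (z j))%:E +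
     (~~ x i j)%:R%:E * lne (1 - pi (z i) (z j))%R%:E).

Definition L2 x alpha pi : \bar R :=
  lne (\sum_z expeR (L1 x z pi) * (\prod_(i < n) alpha (z i))%R%:E).

Definition is_maximizer (zeta gamma : R) x alpha pi : Prop :=
  admissible zeta gamma alpha pi /\
  forall alpha' pi', admissible zeta gamma alpha' pi' ->
    L2 x alpha' pi' <= L2 x alpha pi.

Definition has_maximizer (zeta gamma : R) x : Prop :=
  exists alpha pi, is_maximizer zeta gamma x alpha pi.

End Likelihood.

Arguments has_maximizer {R} Q {n} zeta gamma x.

(* An estimator is a function of the observed adjacency matrix. *)
Definition is_mle {R : realType} {Q : nat} (zeta gamma : R)
    (ahat : forall n, 'M[bool]_n -> 'I_Q -> R)
    (pihat : forall n, 'M[bool]_n -> 'M[R]_Q) : Prop :=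
  forall n (x : 'M[bool]_n),
    has_maximizer Q zeta gamma x ->
    is_maximizer zeta gamma x (ahat n x) (pihat n x).

(* Existence of a maximizer cannot be required for every adjacency matrix,
   because A1 does not define a closed set.  For Q = 2, zeta < 1/2 and the
   directed 3-cycle, L2 has supremum - 6 ln 2, which on the closure of the
   parameter set is reached only at the constant matrix 1/2; so there is no
   maximizer satisfying A1, and that graph has positive probability as soon as
   the entries of the true matrix are in ]0, 1[.  Existence is therefore asked
   for with probability tending to one. *)
Definition maximizer_exists_whp {R : realType} (Q : nat)
    {d : measure_display} {T : measurableType d} (P : probability T R)
    (X : nat -> nat -> T -> bool) (zeta gamma : R) : Prop :=
  P [set w | has_maximizer Q zeta gamma (adjacency X n w)] @[n --> \oo]
    --> 1%E.

Section Distance.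
Context {R : realType} {Q : nat}.
Implicit Types p q r : 'M[R]_Q.

Definition usual_distance (d0 : 'M[R]_Q -> 'M[R]_Q -> R) : Prop :=
  [/\ forall p q, 0 <= d0 p q,
      forall p q, d0 p q = 0 <-> p = q,
      forall p q, d0 p q = d0 q p,
      forall p q r, d0 p r <= d0 p q + d0 q r
    & forall p (A : set 'M[R]_Q),
        nbhs p A <-> exists2 e : R, 0 < e & [set q | d0 p q < e] `<=` A].

Definition relabel (s : 'S_Q) p : 'M[R]_Q := \matrix_(q, l) p (s q) (s l).

(* The default value of the iterated minimum is the term of the identity. *)
Definition dist_upto_switch (d0 : 'M[R]_Q -> 'M[R]_Q -> R) p q : R :=
  \big[Num.min/d0 (relabel 1%g p) q]_(s : 'S_Q) d0 (relabel s p) q.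

End Distance.

Definition cvg_in_probability {R : realType} {d : measure_display}
    {T : measurableType d} (P : probability T R) (Y : nat -> T -> R) (l : R) :
    Prop :=
  forall eps : R, 0 < eps ->
    P [set w | eps <= `|Y n w - l|] @[n --> \oo] --> 0%E.

(* Main.v *)
Require Import Defs.
From HB Require Import structures.
From mathcomp Require Import all_boot all_order all_algebra all_fingroup.
From mathcomp Require Import all_classical all_reals all_analysis.
From mathcomp Require Import ring lra.
Import Order.TTheory GRing.Theory Num.Theory.
Import numFieldNormedType.Exports.
Local Open Scope classical_set_scope.
Local Open Scope ring_scope.
Set Implicit Arguments.
Unset Strict Implicit.

(** The maximum-likelihood parameter need only be compared with the true one
    through the likelihood given labels.  Write l(x; z, pi) for the probability
    of the graph x given the labels z.  The integrated likelihood is an average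
    of l(x; z, pi) over z with weights at least gamma^n, so a maximizer
    (alpha, pi) of L2 admits labels z with

      l(x; z, pi) >= gamma^n l(x; zs, pis),      (1)

    where zs are the true labels and pis the true connectivities
    ([likelihood_of_L2_le]).  A factor gamma^n is negligible here, since the
    graph carries of the order of n^2 independent observations.

    Given zs, fix z and pi.  By Markov's inequality applied to the square root
    of the likelihood ratio, (1) has probability at most gamma^-n times the
    product over i != j of the Bhattacharyya affinities of the Bernoulli laws of
    parameters pi(z_i, z_j) and pis(zs_i, zs_j), hence at most
    gamma^-n exp(- D / 4), where D, called the discrepancy, is the sum of the
    squared differences of these parameters ([likelihood_ratio_tail]).  The
    bound remains true up to exp(2 eta n^2) when pi and 1 - pi are replaced by
    upper bounds at distance eta^2, so a finite grid of such bounds covers all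
    parameters pi, zero and one included, where logarithms are infinite.  There
    are Q^n labelings and a number of grid points independent of n; a union
    bound shows that (1) with D >= delta n^2 has vanishing probability for every
    delta > 0 ([fitting_tail]).

    It remains to see that a small discrepancy forces pi to be close to pis up
    to a permutation ([discrepancy_identifies]).  With overwhelming probability
    every true class q contains a positive fraction of the vertices
    ([small_class_prior_le]).  Let f q be the label that z uses most often on
    class q.  The pairs of vertices counted by f q and f l are a positive
    fraction of the n^2 pairs, so pi (f q) (f l) is close to pis q l.  If f
    identified two classes, these would have almost equal rows and columns in
    pis, against A1; hence f is a permutation, the one that aligns pi with
    pis.

    All probabilities above are finite sums, because the labels of the first n
    vertices and their adjacency matrix have a joint law with an explicit mass
    function ([joint_law]). *)

(** * Affinity of Bernoulli laws *)

Lemma sqr_diff_le_sqrt (R : rcfType) (p q : R) :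
  0 <= p <= 1 -> 0 <= q <= 1 ->
  (p - q) ^+ 2 <= 4 * (Num.sqrt p - Num.sqrt q) ^+ 2.
Proof.
move=> /andP[p0 p1] /andP[q0 q1].
have a0 := sqrtr_ge0 p; have b0 := sqrtr_ge0 q.
have a2 := sqr_sqrtr p0; have b2 := sqr_sqrtr q0.
have a1 : Num.sqrt p <= 1 by rewrite -sqrtr1 ler_wsqrtr.
have b1 : Num.sqrt q <= 1 by rewrite -sqrtr1 ler_wsqrtr.
rewrite -{1}a2 -{1}b2 subr_sqr exprMn mulrC ler_wpM2r ?sqr_ge0//.
by nra.
Qed.

(** One minus the affinity is half the sum of the squared differences of the
    square roots of the weights, and each of them is at least a quarter of
    (p - q)^2 since square roots of numbers in [0, 1] have sum at most 2. *)
Lemma bernoulli_affinity_le (R : rcfType) (p q : R) :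
  0 <= p <= 1 -> 0 <= q <= 1 ->
  Num.sqrt (p * q) + Num.sqrt ((1 - p) * (1 - q)) <= 1 - (p - q) ^+ 2 / 4.
Proof.
move=> hp hq.
have h1 := sqr_diff_le_sqrt hp hq.
have hp' : 0 <= 1 - p <= 1 by lra.
have hq' : 0 <= 1 - q <= 1 by lra.
have h2 := sqr_diff_le_sqrt hp' hq'.
rewrite !sqrtrM; try lra.
have a2 : Num.sqrt p ^+ 2 = p by rewrite sqr_sqrtr; lra.
have b2 : Num.sqrt q ^+ 2 = q by rewrite sqr_sqrtr; lra.
have c2 : Num.sqrt (1 - p) ^+ 2 = 1 - p by rewrite sqr_sqrtr; lra.
have d2 : Num.sqrt (1 - q) ^+ 2 = 1 - q by rewrite sqr_sqrtr; lra.
rewrite [X in _ <= 4 * X]sqrrB a2 b2 in h1.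
rewrite [X in _ <= 4 * X]sqrrB c2 d2 in h2.
have e : (1 - p - (1 - q)) ^+ 2 = (p - q) ^+ 2 by ring.
rewrite e in h2; lra.
Qed.

Lemma sqrtrD_le (R : rcfType) (x y : R) :
  0 <= x -> 0 <= y -> Num.sqrt (x + y) <= Num.sqrt x + Num.sqrt y.
Proof.
move=> x0 y0; rewrite -(@ler_sqr R) ?nnegrE ?addr_ge0 ?sqrtr_ge0//.
rewrite sqr_sqrtr ?addr_ge0// sqrrD !sqr_sqrtr//.
have := mulr_ge0 (sqrtr_ge0 x) (sqrtr_ge0 y); lra.
Qed.

Lemma sqrt_mul_bracket (R : rcfType) (u p q eta : R) :
  0 <= p -> 0 <= q <= 1 -> 0 <= eta -> u <= p + eta ^+ 2 ->
  Num.sqrt (u * q) <= Num.sqrt (p * q) + eta.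
Proof.
move=> p0 /andP[q0 q1] eta0 hu.
apply: (@le_trans _ _ (Num.sqrt (p * q + eta ^+ 2))).
  rewrite ler_wsqrtr//; have := sqr_ge0 eta; nra.
rewrite (le_trans (sqrtrD_le _ _))// ?mulr_ge0 ?sqr_ge0//.
by rewrite sqrtr_sqr ger0_norm.
Qed.

(** Replacing p and 1 - p by upper bounds u and v costs only eta per term,
    because the square root is subadditive; the exponential form is the one that
    multiplies over edges. *)
Lemma bracket_affinity_le (R : realType) (u v p q eta : R) :
  0 <= p <= 1 -> 0 <= q <= 1 -> 0 <= eta ->
  u <= p + eta ^+ 2 -> v <= 1 - p + eta ^+ 2 ->
  Num.sqrt (u * q) + Num.sqrt (v * (1 - q)) <=
  expR (2 * eta - (p - q) ^+ 2 / 4).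
Proof.
move=> hp hq eta0 hu hv.
apply: le_trans (expR_ge1Dx _).
have h := bernoulli_affinity_le hp hq.
have h1 : Num.sqrt (u * q) <= Num.sqrt (p * q) + eta.
  by apply: sqrt_mul_bracket => //; lra.
have h2 : Num.sqrt (v * (1 - q)) <= Num.sqrt ((1 - p) * (1 - q)) + eta.
  by apply: sqrt_mul_bracket => //; lra.
lra.
Qed.

(** * The likelihood given the labels *)

Definition likelihood {R : realType} {Q n : nat} (x : 'M[bool]_n)
    (z : {ffun 'I_n -> 'I_Q}) (pi : 'M[R]_Q) : R :=
  \prod_(i < n) \prod_(j < n | i != j) bernoulli_pmf (pi (z i) (z j)) (x i j).

Section LikelihoodTheory.
Context {R : realType} {Q n : nat}.
Implicit Types (x : 'M[bool]_n) (z : {ffun 'I_n -> 'I_Q}).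
Implicit Types (alpha : 'I_Q -> R) (pi : 'M[R]_Q).

Lemma likelihood_ge0 x z pi :
  (forall q l, 0 <= pi q l <= 1) -> 0 <= likelihood x z pi.
Proof.
by move=> hpi; do 2!apply: prodr_ge0 => ? _; exact: bernoulli_pmf_ge0.
Qed.

Lemma expeR_L1 x z pi : (forall q l, 0 <= pi q l <= 1) ->
  expeR (L1 x z pi) = (likelihood x z pi)%:E.
Proof.
move=> hpi; rewrite /L1 /likelihood.
have expeR_sum (I : Type) (r : seq I) (p : pred I) (F : I -> \bar R) :
    expeR (\sum_(i <- r | p i) F i)%E = (\prod_(i <- r | p i) expeR (F i))%E.
  by apply: big_morph; [exact: expeRD|exact: expeR0].
rewrite expeR_sum -prodEFin; apply: eq_bigr => i _.
rewrite expeR_sum -prodEFin; apply: eq_bigr => j _.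
have /andP[p0 p1] := hpi (z i) (z j).
rewrite /bernoulli_pmf; case: (x i j).
  rewrite mul1e mul0e adde0; apply/eqP; by rewrite lneK_eq lee_fin.
rewrite mul1e mul0e add0e; apply/eqP; by rewrite lneK_eq lee_fin subr_ge0.
Qed.

Definition prior alpha z : R := \prod_i alpha (z i).

Lemma sum_prior alpha : \sum_q alpha q = 1 -> \sum_z prior alpha z = 1.
Proof.
move=> h; rewrite -(bigA_distr_bigA (fun (_ : 'I_n) q => alpha q)) /=.
by rewrite h big1.
Qed.

Lemma L2E x alpha pi : (forall q l, 0 <= pi q l <= 1) ->
  L2 x alpha pi = lne (\sum_z prior alpha z * likelihood x z pi)%:E.
Proof.
move=> hpi; rewrite /L2 -sumEFin; congr lne; apply: eq_bigr => z _.
by rewrite expeR_L1// mulrC.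
Qed.

(** Keep a single term of the average defining L2 for the smaller likelihood,
    and bound the average by its largest term for the other one.  The prior
    weight of z' is what is lost. *)
Lemma likelihood_of_L2_le x alpha pi alpha' pi' z' :
  sbm_param alpha pi -> sbm_param alpha' pi' ->
  (L2 x alpha' pi' <= L2 x alpha pi)%E ->
  exists z, prior alpha' z' * likelihood x z' pi' <= likelihood x z pi.
Proof.
move=> [ha ha1 hpi] [ha' ha1' hpi'].
have prior_ge0 (a : 'I_Q -> R) z : (forall q, 0 < a q < 1) -> 0 <= prior a z.
  by move=> h; apply: prodr_ge0 => i _; have /andP[/ltW] := h (z i).
have term_ge0 (a : 'I_Q -> R) (p : 'M[R]_Q) z : (forall q, 0 < a q < 1) ->
    (forall q l, 0 <= p q l <= 1) -> 0 <= prior a z * likelihood x z p.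
  by move=> h1 h2; rewrite mulr_ge0 ?prior_ge0 ?likelihood_ge0.
rewrite !L2E// lee_lne ?in_itv/= ?leey ?andbT ?lee_fin ?sumr_ge0//;
  try by move=> z _; exact: term_ge0.
move=> h.
pose z0 := [arg max_(z > z') likelihood x z pi]%O.
exists z0; have hz0 z : likelihood x z pi <= likelihood x z0 pi.
  by rewrite /z0; case: Order.TotalTheory.arg_maxP => // m _; apply.
apply: le_trans (le_trans h _); last first.
  rewrite -[leRHS]mul1r -(sum_prior ha1) mulr_suml; apply: ler_sum => z _.
  by rewrite ler_wpM2l ?prior_ge0.
rewrite (bigD1 z')//= lerDl; apply: sumr_ge0 => z _; exact: term_ge0.
Qed.

End LikelihoodTheory.

(** * Joint law of the labels and of the adjacency matrix *)

Section FiniteValued.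
Context {R : realType} {d : measure_display} {T : measurableType d}.
Context (K : finType) (Y : T -> K).
Hypothesis mY : forall k, measurable (Y @^-1` [set k]).

Lemma preimage_pred_bigcup (B : pred K) :
  [set w | B (Y w)] = \bigcup_(k in [set` B]) Y @^-1` [set k].
Proof.
by apply/seteqP; split => [w Bw|w [k Bk /= ->]]; [exists (Y w)|].
Qed.

Lemma measurable_finite_valued (B : pred K) : measurable [set w | B (Y w)].
Proof.
rewrite preimage_pred_bigcup; exact: fin_bigcup_measurable.
Qed.

Lemma measure_finite_valued (mu : probability T R) (B : pred K) :
  mu [set w | B (Y w)] = (\sum_(k | B k) mu (Y @^-1` [set k]))%E.
Proof.
rewrite preimage_pred_bigcup measure_fin_bigcup//.
- by rewrite (bigfs _ (index_enum_uniq K))// => k _; rewrite mem_index_enum.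
- apply/trivIsetP => i j _ _ /eqP ij.
  by apply/seteqP; split => // w [/= -> /ij].
Qed.
End FiniteValued.

(** The hypotheses on the model speak of labels and graphs indexed by [nat];
    this extends by a default value those indexed by ['I_n]. *)
Definition ord_ext {U : Type} {n : nat} (u : U) (f : 'I_n -> U) (k : nat) : U :=
  if insub k is Some i then f i else u.

Lemma ord_extE U n (u : U) (f : 'I_n -> U) (i : 'I_n) : ord_ext u f i = f i.
Proof. by rewrite /ord_ext valK. Qed.

Definition labels {Q : nat} {T : Type} (Z : nat -> T -> 'I_Q) (n : nat)
  (w : T) : {ffun 'I_n -> 'I_Q} := [ffun i => Z (val i) w].

Definition loopless {n : nat} (x : 'M[bool]_n) := [forall i, ~~ x i i].

Section FiniteLaw.
Context {R : realType} {Q : nat} {d : measure_display} {T : measurableType d}.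
Context (P : probability T R).
Context (Z : nat -> T -> 'I_Q) (X : nat -> nat -> T -> bool).
Context (alpha : 'I_Q -> R) (pi : 'M[R]_Q).
Hypotheses (hsbm : is_sbm P Z X alpha pi).

Lemma labels_preimage n (z : {ffun 'I_n -> 'I_Q}) :
  labels Z n @^-1` [set z] =
  \bigcap_(i in [set: 'I_n]) Z (val i) @^-1` [set z i].
Proof.
apply/seteqP; split => [w /= <- i _|w h]; first by rewrite /labels /= ffunE.
by apply/ffunP => i; rewrite ffunE; exact: h.
Qed.

Lemma measurable_labels n (z : {ffun 'I_n -> 'I_Q}) :
  measurable (labels Z n @^-1` [set z]).
Proof.
have [[mZ _ _] _] := hsbm.
by rewrite labels_preimage; apply: fin_bigcap_measurable.
Qed.

Lemma label_event_labels n (z : {ffun 'I_n -> 'I_Q}) :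
  <<s label_events Z >> (labels Z n @^-1` [set z]).
Proof.
rewrite labels_preimage.
apply: (@fin_bigcap_measurable _ (g_sigma_algebraType (label_events Z))) => //.
by move=> i _; apply: sub_sigma_algebra; exists (val i), (z i).
Qed.

Lemma adjacency_preimage n (x : 'M[bool]_n) :
  adjacency X n @^-1` [set x] =
  \bigcap_(e in [set: 'I_n * 'I_n]) X (val e.1) (val e.2) @^-1` [set x e.1 e.2].
Proof.
apply/seteqP; split => [w /= <- i _|w h]; first by rewrite /= mxE.
by apply/matrixP => i j; rewrite mxE; exact: (h (i, j)).
Qed.

Lemma measurable_adjacency n (x : 'M[bool]_n) :
  measurable (adjacency X n @^-1` [set x]).
Proof.
have [_ [mX _ _]] := hsbm.
rewrite adjacency_preimage; apply: fin_bigcap_measurable => // e _.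
rewrite -[_ @^-1` _]setTI; exact: mX.
Qed.

Lemma labels_law n (z : {ffun 'I_n -> 'I_Q}) :
  P (labels Z n @^-1` [set z]) = (prior alpha z)%:E.
Proof.
have [[_ hZ1 hZ2] _] := hsbm.
(* A sample point provides a default label, needed to extend z to [nat]. *)
have [w0 _] : [set: T] !=set0.
  apply/set0P/eqP => h; have := probability_setT P.
  by rewrite h measure0 => /esym/eqP; rewrite onee_eq0.
have -> : labels Z n @^-1` [set z] =
    [set w | forall i, i \in iota 0 n -> Z i w = ord_ext (Z 0 w0) z i].
  apply/seteqP; split => [w /= <- k|w h].
    rewrite mem_iota add0n /= => kn.
    by rewrite -[k]/(val (Ordinal kn)) ord_extE ffunE.
  apply/ffunP => i; rewrite ffunE h ?ord_extE//.
  by rewrite mem_iota add0n /=.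
rewrite hZ2 ?iota_uniq// -[n in iota 0 n]subn0 -/(index_iota 0 n) big_mkord.
by rewrite /prior -prodEFin; apply: eq_bigr => i _; rewrite hZ1 ord_extE.
Qed.

(** The event that the labels are z is generated by the labels, and on it the
    conditional probability of the graph is constant, equal to the likelihood.
    The likelihood ignores the diagonal, which is almost surely false; this is
    the role of the factor [loopless x]. *)
Lemma joint_law n (z : {ffun 'I_n -> 'I_Q}) (x : 'M[bool]_n) :
  P (labels Z n @^-1` [set z] `&` adjacency X n @^-1` [set x]) =
  ((loopless x)%:R * (prior alpha z * likelihood x z pi))%:E.
Proof.
have [_ [_ X0 hX]] := hsbm.
have [xl|/forallPn[i]] := boolP (loopless x); last first.
  rewrite negbK => xii; rewrite mul0r (_ : _ `&` _ = set0) ?measure0//.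
  apply/seteqP; split => // w [_ /= /matrixP/(_ i i)].
  by rewrite mxE X0 xii.
pose s := [seq (val e.1, val e.2) | e <- enum {: 'I_n * 'I_n} & e.1 != e.2].
pose x' i j := ord_ext false (fun k => ord_ext false (x k) j) i.
have x'E (i j : 'I_n) : x' i j = x i j by rewrite /x' !ord_extE.
have sP (i j : nat) : reflect
    (exists e : 'I_n * 'I_n, [/\ e.1 != e.2, i = e.1 & j = e.2]) ((i, j) \in s).
  apply: (iffP mapP) => [[e]|[e [ne -> ->]]].
    by rewrite mem_filter => /andP[ne _] [-> ->]; exists e.
  by exists e; rewrite // mem_filter ne mem_enum.
have us : uniq s.
  rewrite map_inj_uniq; first by apply: filter_uniq; exact: enum_uniq.
  by move=> [a b] [a' b'] /= [/val_inj-> /val_inj->].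
have ds : all (fun e => e.1 != e.2) s.
  by apply/allP => -[i j] /sP [e [ne -> ->]].
have -> : adjacency X n @^-1` [set x] =
    [set w | forall i j, (i, j) \in s -> X i j w = x' i j].
  apply/seteqP; split => [w /= wx _ _ /sP[e [_ -> ->]]|w h].
    by rewrite x'E -wx mxE.
  apply/matrixP => i j; rewrite mxE.
  have [->|ij] := eqVneq i j; first by rewrite X0 (negbTE (forallP xl j)).
  by rewrite h ?x'E//; apply/sP; exists (i, j).
rewrite hX//; last exact: label_event_labels.
rewrite mul1r (eq_integral (cst (likelihood x z pi)%:E)); last first.
  move=> w; rewrite inE /= => wz; congr EFin.
  rewrite big_map big_filter big_enum_cond /= /likelihood pair_big_dep /=.
  by apply: eq_bigr => e _; rewrite x'E -wz !ffunE.
rewrite integral_cst; last exact: measurable_labels.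
by rewrite [X in (_ * X)%E]labels_law -EFinM mulrC.
Qed.

Definition sample n (w : T) := (labels Z n w, adjacency X n w).

Lemma sample_preimage n k : sample n @^-1` [set k] =
  labels Z n @^-1` [set k.1] `&` adjacency X n @^-1` [set k.2].
Proof.
by case: k => z x; apply/seteqP; split=> w; rewrite /sample /= => -[-> ->].
Qed.

Lemma measurable_sample n k : measurable (sample n @^-1` [set k]).
Proof.
rewrite sample_preimage; apply: measurableI.
  exact: measurable_labels.
exact: measurable_adjacency.
Qed.

Lemma sample_law n (B : pred ({ffun 'I_n -> 'I_Q} * 'M[bool]_n)) :
  P [set w | B (sample n w)] =
  (\sum_z prior alpha z *
     \sum_(x | loopless x && B (z, x)) likelihood x z pi)%:E.
Proof.
rewrite measure_finite_valued; last exact: measurable_sample.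
under eq_bigr do rewrite sample_preimage joint_law.
rewrite sumEFin; congr EFin; under [RHS]eq_bigr do rewrite mulr_sumr.
rewrite pair_big_dep /= [LHS]big_mkcond [RHS]big_mkcond /=.
apply: eq_bigr => -[z x] _ /=.
by case: (loopless x) => /=; rewrite ?mul1r ?mul0r ?if_same.
Qed.

End FiniteLaw.

(** * Sizes of the classes *)

Definition class_size {Q n : nat} (z : {ffun 'I_n -> 'I_Q}) (q : 'I_Q) : nat :=
  #|[pred i | z i == q]|.

Lemma expRN1_le_half (R : realType) : expR (-1) <= 2^-1 :> R.
Proof.
rewrite expRN lef_pV2 ?posrE ?expR_gt0//.
by apply: le_trans (expR_ge1Dx _); lra.
Qed.

(** Markov's inequality for exp(- class_size): its mean is the n-th power of
    1 - alpha q (1 - 1/e) <= exp(- gamma / 2), and the threshold loses the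
    factor exp(gamma n / 4). *)
Lemma small_class_prior_le (R : realType) (Q n : nat) (gamma : R)
    (alpha : 'I_Q -> R) (q : 'I_Q) :
  (forall a, 0 <= alpha a) -> \sum_a alpha a = 1 -> gamma <= alpha q ->
  \sum_(z : {ffun 'I_n -> 'I_Q} | (class_size z q)%:R <= gamma / 4 * n%:R)
    prior alpha z <= expR (- (gamma / 4)) ^+ n.
Proof.
move=> a0 a1 hg.
have step1 : \sum_a alpha a * expR (- (a == q)%:R) <= expR (- (gamma / 2)).
  apply: le_trans (expR_ge1Dx _).
  rewrite -[X in _ <= X + _]a1 !(bigD1 (P := xpredT) q)//= eqxx.
  have -> : \sum_(i | i != q) alpha i * expR (- (i == q)%:R) =
      \sum_(i | i != q) alpha i.
    by apply: eq_bigr => i /negbTE ->; rewrite oppr0 expR0 mulr1.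
  have := expRN1_le_half R; have := a0 q.
  move: (expR (-1)) (\sum_(_ | _) _) => e s; nra.
apply: (@le_trans _ _ (\sum_(z : {ffun 'I_n -> 'I_Q})
    expR (gamma / 4) ^+ n * \prod_i (alpha (z i) * expR (- (z i == q)%:R)))).
  rewrite big_mkcond; apply: ler_sum => z _.
  have prior0 : 0 <= prior alpha z by apply: prodr_ge0 => i _; exact: a0.
  have -> : expR (gamma / 4) ^+ n *
      \prod_i (alpha (z i) * expR (- (z i == q)%:R)) =
      prior alpha z * expR (gamma / 4 * n%:R - (class_size z q)%:R).
    rewrite big_split /= -expR_sum -expRM_natl mulrCA -expRD.
    congr (_ * expR _).
    rewrite mulrC sumrN -natr_sum; congr (_ - _%:R).
    by rewrite /class_size -sum1_card [RHS]big_mkcond; apply: eq_bigr => i _;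
      rewrite inE; case: eqP.
  case: ifPn => [h|_]; last by rewrite mulr_ge0 ?expR_ge0.
  by rewrite ler_peMr// (le_trans _ (expR_ge1Dx _))// lerDl subr_ge0.
rewrite -mulr_sumr.
rewrite -(bigA_distr_bigA (fun (_ : 'I_n) a => alpha a * expR (- (a == q)%:R))).
rewrite /= prodr_const card_ord -exprMn lerXn2r ?nnegrE ?expR_ge0//.
  by rewrite mulr_ge0 ?expR_ge0 ?sumr_ge0// => a _; rewrite mulr_ge0 ?expR_ge0.
have -> : - (gamma / 4) = gamma / 4 + - (gamma / 2) by field.
by rewrite expRD ler_wpM2l ?expR_ge0.
Qed.

(** * Tail of the likelihood ratio *)

(** The likelihood is the case u = pi, v = 1 - pi; allowing other pairs gives
    room for upper bounds whose sum exceeds one. *)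
Definition edge_product {R : realType} {Q n : nat} (x : 'M[bool]_n)
    (z : {ffun 'I_n -> 'I_Q}) (u v : 'M[R]_Q) : R :=
  \prod_(i < n) \prod_(j < n | i != j)
    (if x i j then u (z i) (z j) else v (z i) (z j)).

(** A loopless graph chooses each off-diagonal entry freely, so the sum of a
    product over the edges factors. *)
Lemma sum_loopless (R : comNzRingType) n (F : 'I_n -> 'I_n -> bool -> R) :
  \sum_(x : 'M[bool]_n | loopless x) \prod_i \prod_(j | i != j) F i j (x i j) =
  \prod_i \prod_(j | i != j) (F i j true + F i j false).
Proof.
pose G (e : 'I_n * 'I_n) b :=
  if e.1 == e.2 then (~~ b)%:R else F e.1 e.2 b.
transitivity (\sum_(x : 'M[bool]_n) \prod_e G e (x e.1 e.2)).
  rewrite big_mkcond; apply: eq_bigr => x _.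
  case: ifPn => [/forallP xl|/forallPn[i]].
    rewrite pair_big_dep /= big_mkcond /=; apply: eq_bigr => e _.
    rewrite /G; case: eqVneq => //= ->; by rewrite xl.
  rewrite negbK => xii; rewrite (bigD1 (i, i))//= /G /= eqxx xii /=.
  by rewrite mul0r.
rewrite (reindex (fun f : {ffun 'I_n * 'I_n -> bool} =>
  \matrix_(i, j) f (i, j))); last first.
  exists (fun x : 'M[bool]_n => [ffun e => x e.1 e.2]) => f _.
    by apply/ffunP => -[i j]; rewrite ffunE mxE.
  by apply/matrixP => i j; rewrite mxE ffunE.
under eq_bigr => f _ do under eq_bigr => e _ do rewrite mxE -surjective_pairing.
rewrite -(bigA_distr_bigA G) pair_big_dep /= [RHS]big_mkcond.
apply: eq_bigr => e _; rewrite big_bool /G /=.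
by case: eqVneq => //= _; rewrite add0r.
Qed.

Lemma sqrtr_prod (R : rcfType) (I : Type) (r : seq I) (p : pred I)
    (F : I -> R) :
  (forall i, p i -> 0 <= F i) ->
  Num.sqrt (\prod_(i <- r | p i) F i) = \prod_(i <- r | p i) Num.sqrt (F i).
Proof.
move=> F0; elim: r => [|i r ih]; first by rewrite !big_nil sqrtr1.
by rewrite !big_cons; case: ifPn => // pi; rewrite sqrtrM ?F0// ih.
Qed.

Section LikelihoodRatio.
Context {R : realType} {Q n : nat}.
Implicit Types (z zs : {ffun 'I_n -> 'I_Q}) (pi pis u v : 'M[R]_Q).

Definition discrepancy z pi zs pis : R :=
  \sum_(i < n) \sum_(j < n | i != j) (pi (z i) (z j) - pis (zs i) (zs j)) ^+ 2.

Definition brackets (eta : R) pi u v :=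
  forall q l, pi q l <= u q l <= pi q l + eta ^+ 2 /\
    1 - pi q l <= v q l <= 1 - pi q l + eta ^+ 2.

Lemma likelihood_le_bracket (x : 'M[bool]_n) z eta pi u v :
  (forall q l, 0 <= pi q l <= 1) -> brackets eta pi u v ->
  likelihood x z pi <= edge_product x z u v.
Proof.
move=> hpi hb; apply: ler_prod => i _; apply/andP; split.
  by apply: prodr_ge0 => j _; exact: bernoulli_pmf_ge0.
apply: ler_prod => j _; rewrite bernoulli_pmf_ge0//= /bernoulli_pmf.
by have [/andP[h _] /andP[h' _]] := hb (z i) (z j); case: ifP.
Qed.

(** Where c l <= e, for l the true likelihood and e the [edge_product], one has
    c l <= sqrt (e l) because c <= 1.  Summed over all graphs, sqrt (e l)
    factors into one affinity per ordered pair of vertices. *)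
Lemma likelihood_ratio_tail zs z pis pi u v (eta delta c : R) :
  (forall q l, 0 <= pis q l <= 1) -> (forall q l, 0 <= pi q l <= 1) ->
  0 <= eta -> brackets eta pi u v -> 0 < c <= 1 ->
  delta * n%:R ^+ 2 <= discrepancy z pi zs pis ->
  \sum_(x | loopless x && (c * likelihood x zs pis <= edge_product x z u v))
    likelihood x zs pis <=
  c^-1 * expR ((2 * eta - delta / 4) * n%:R ^+ 2).
Proof.
move=> hpis hpi eta0 hb /andP[c0 c1] hd.
have u0 q l : 0 <= u q l.
  have [/andP[h _] _] := hb q l; have /andP[h' _] := hpi q l; lra.
have v0 q l : 0 <= v q l.
  have [_ /andP[h _]] := hb q l; have /andP[_ h'] := hpi q l; lra.
have ep0 x : 0 <= edge_product x z u v.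
  by do 2!apply: prodr_ge0 => ? _; case: ifP.
pose aff i j b : R :=
  Num.sqrt ((if b then u (z i) (z j) else v (z i) (z j)) *
            bernoulli_pmf (pis (zs i) (zs j)) b).
apply: (@le_trans _ _ (c^-1 *
    \sum_(x : 'M[bool]_n | loopless x)
      \prod_i \prod_(j | i != j) aff i j (x i j))).
  rewrite big_mkcondr mulr_sumr; apply: ler_sum => x _.
  have -> : \prod_i \prod_(j | i != j) aff i j (x i j) =
      Num.sqrt (edge_product x z u v * likelihood x zs pis).
    rewrite -big_split sqrtr_prod => [|i _]; last first.
      by rewrite mulr_ge0// prodr_ge0// => j _;
        [case: ifP|exact: bernoulli_pmf_ge0].
    apply: eq_bigr => i _; rewrite -big_split sqrtr_prod// => j _.
    by rewrite mulr_ge0 ?bernoulli_pmf_ge0//; case: ifP.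
  have l0 := likelihood_ge0 x zs hpis.
  case: ifPn => [h|_]; last by rewrite mulr_ge0 ?sqrtr_ge0 ?invr_ge0 ?ltW.
  rewrite mulrC ler_pdivlMr//.
  have cl0 := mulr_ge0 l0 (ltW c0).
  rewrite -(ger0_norm cl0) -sqrtr_sqr ler_wsqrtr//.
  rewrite expr2 [leRHS]mulrC ler_pM//; first by rewrite ler_piMr.
  by rewrite mulrC.
rewrite ler_wpM2l ?invr_ge0 ?(ltW c0)// sum_loopless.
apply: (@le_trans _ _ (\prod_(i < n) \prod_(j < n | i != j)
    expR (2 * eta - (pi (z i) (z j) - pis (zs i) (zs j)) ^+ 2 / 4))).
  apply: ler_prod => i _; apply/andP; split.
    by apply: prodr_ge0 => j _; rewrite addr_ge0 ?sqrtr_ge0.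
  apply: ler_prod => j _; rewrite addr_ge0 ?sqrtr_ge0//=.
  have [/andP[_ hu] /andP[_ hv]] := hb (z i) (z j).
  exact: (bracket_affinity_le (hpi _ _) (hpis _ _) eta0 hu hv).
under eq_bigr do rewrite -expR_sum.
rewrite -expR_sum ler_expR.
under eq_bigr do rewrite big_split /=.
rewrite big_split /=.
have -> : \sum_(i < n) \sum_(j < n | i != j)
    - ((pi (z i) (z j) - pis (zs i) (zs j)) ^+ 2 / 4) =
    - (discrepancy z pi zs pis / 4).
  rewrite /discrepancy mulr_suml -sumrN; apply: eq_bigr => i _.
  by rewrite mulr_suml -sumrN.
have : \sum_(i < n) \sum_(j < n | i != j) 2 * eta <= 2 * eta * n%:R ^+ 2.
  apply: (@le_trans _ _ (\sum_(i < n) \sum_(j < n) 2 * eta)).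
    apply: ler_sum => i _; rewrite [leRHS](bigID (fun j => i != j))/= lerDl.
    by apply: sumr_ge0 => j _; lra.
  by rewrite !sumr_const !card_ord -mulrnA -natrX mulr_natr mulnn.
lra.
Qed.

End LikelihoodRatio.

(** * Union bound over labelings and parameters *)

Section Grid.
Context {R : realType} {Q n N : nat}.
Implicit Types (z zs : {ffun 'I_n -> 'I_Q}) (pi pis : 'M[R]_Q).
Implicit Types (k : 'M['I_N.+2]_Q).

Definition grid_upper k : 'M[R]_Q := \matrix_(q, l) ((k q l).+1%:R / N.+1%:R).
Definition grid_lower k : 'M[R]_Q := \matrix_(q, l) (1 - (k q l)%:R / N.+1%:R).

(** With M = N + 1 and k the integer part of M p, the numbers (k + 1) / M and
    1 - k / M exceed p and 1 - p by at most 1 / M.  For p = 1 one has k = M, so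
    k takes N + 2 values. *)
Lemma exists_grid_bracket eta pi : N.+1%:R^-1 <= eta ^+ 2 ->
  (forall q l, 0 <= pi q l <= 1) ->
  exists k, brackets eta pi (grid_upper k) (grid_lower k).
Proof.
move=> hN hpi.
pose k : 'M['I_N.+2]_Q := \matrix_(q, l) inord (Num.truncn (pi q l * N.+1%:R)).
exists k => q l; rewrite !mxE.
have /andP[p0 p1] := hpi q l.
have t0 : 0 <= pi q l * N.+1%:R by rewrite mulr_ge0.
have := truncn_itv t0; set t := Num.truncn _ => /andP[h1 h2].
have tN : (t < N.+2)%N.
  by rewrite ltnS -(ler_nat R) (le_trans h1)// ler_piMl.
rewrite inordK//.
have N0 : 0 < N.+1%:R :> R by rewrite ltr0n.
rewrite -ler_pdivrMr// in h1.
rewrite -ltr_pdivlMr// in h2.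
rewrite -addn1 natrD mulrDl div1r in h2 *.
move: h1 h2 hN; set a := t%:R / _; set b := _^-1 => h1 h2 hN.
by split; apply/andP; split; lra.
Qed.

(** There are uncountably many pi, but the event for z and pi is contained in
    the one for z and a grid bracket of pi; so a union bound over the labelings
    z and the grid points k suffices.  Only the pairs (z, k) for which some pi
    bracketed by k has large discrepancy are counted, and for them
    [likelihood_ratio_tail] applies. *)
Lemma fitting_tail zs pis (eta delta c : R) :
  (forall q l, 0 <= pis q l <= 1) ->
  0 <= eta -> N.+1%:R^-1 <= eta ^+ 2 -> 0 < c <= 1 ->
  \sum_(x : 'M[bool]_n | loopless x && `[< exists z pi,
      [/\ forall q l, 0 <= pi q l <= 1,
          c * likelihood x zs pis <= likelihood x z pi
        & delta * n%:R ^+ 2 <= discrepancy z pi zs pis] >])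
    likelihood x zs pis <=
  (Q ^ n * N.+2 ^ (Q * Q))%:R *
    (c^-1 * expR ((2 * eta - delta / 4) * n%:R ^+ 2)).
Proof.
move=> hpis eta0 hN hc.
pose good (zk : {ffun 'I_n -> 'I_Q} * 'M['I_N.+2]_Q) := `[< exists pi,
   [/\ forall q l, 0 <= pi q l <= 1,
       brackets eta pi (grid_upper zk.2) (grid_lower zk.2)
     & delta * n%:R ^+ 2 <= discrepancy zk.1 pi zs pis] >].
pose hit (zk : {ffun 'I_n -> 'I_Q} * 'M['I_N.+2]_Q) (x : 'M[bool]_n) :=
  c * likelihood x zs pis <=
    edge_product x zk.1 (grid_upper zk.2) (grid_lower zk.2).
have l0 x := likelihood_ge0 x zs hpis.
apply: (@le_trans _ _ (\sum_(zk | good zk)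
    \sum_(x | loopless x && hit zk x) likelihood x zs pis)).
  under [leRHS]eq_bigr do rewrite big_mkcondr.
  rewrite exchange_big /= big_mkcondr; apply: ler_sum => x xl.
  case: ifPn => [/asboolP[z [pi [hpi hl hd]]]|_]; last first.
    by apply: sumr_ge0 => zk _; case: ifP.
  have [k hk] := exists_grid_bracket hN hpi.
  have gk : good (z, k) by apply/asboolP; exists pi.
  rewrite (bigD1 (z, k) gk)/= /hit /=.
  rewrite (le_trans hl (likelihood_le_bracket x z hpi hk)) lerDl.
  by apply: sumr_ge0 => zk _; case: ifP.
set b := c^-1 * _.
have b0 : 0 <= b.
  by move/andP: hc => [/ltW c0 _]; rewrite mulr_ge0 ?expR_ge0 ?invr_ge0.
apply: (@le_trans _ _ (\sum_(zk | good zk) b)).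
  apply: ler_sum => zk /asboolP[pi [hpi hk hd]].
  exact: (likelihood_ratio_tail hpis hpi eta0 hk hc hd).
apply: (@le_trans _ _ (\sum_(zk : {ffun 'I_n -> 'I_Q} * 'M['I_N.+2]_Q) b)).
  by rewrite [leRHS](bigID good)/= lerDl sumr_ge0.
by rewrite sumr_const card_prod card_ffun card_mx !card_ord mulr_natl.
Qed.

End Grid.

(** * A small discrepancy identifies the parameter *)

Section Identifiability.
Context {R : realType} {Q n : nat}.
Implicit Types (z zs : {ffun 'I_n -> 'I_Q}) (pi pis : 'M[R]_Q).

Definition overlap zs z (q a : 'I_Q) : nat :=
  #|[pred i | (zs i == q) && (z i == a)]|.

Lemma exists_majority zs z q :
  exists a, (class_size zs q <= Q * overlap zs z q a)%N.
Proof.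
have sumE : class_size zs q = (\sum_a overlap zs z q a)%N.
  rewrite /class_size -sum1_card (partition_big z xpredT)//=.
  by apply: eq_bigr => a _; rewrite sum1_card.
pose a := [arg max_(a > q) overlap zs z q a].
exists a; rewrite sumE -[X in (_ <= X * _)%N]card_ord -sum_nat_const.
apply: leq_sum => b _.
by rewrite /a; case: arg_maxnP => // m _; exact.
Qed.

(** The pairs (i, j) of distinct vertices with i labelled (q, a) and j labelled
    (l, b) each contribute at least r^2.  The factor y - 1 rather than y
    accounts for i = j, which occurs when the two blocks coincide. *)
Lemma discrepancy_ge_block zs z pi pis q l a b (r y : R) :
  0 <= r <= `|pi a b - pis q l| -> 1 <= y ->
  y <= (overlap zs z q a)%:R -> y <= (overlap zs z l b)%:R ->
  r ^+ 2 * (y * (y - 1)) <= discrepancy z pi zs pis.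
Proof.
move=> /andP[r0 hr] y1 hqa hlb.
pose C := [pred i | (zs i == q) && (z i == a)].
pose D := [pred i | (zs i == l) && (z i == b)].
apply: (@le_trans _ _ (\sum_(i in C) \sum_(j in D | i != j) r ^+ 2)).
  have inner (i : 'I_n) : r ^+ 2 * (y - 1) <= \sum_(j in D | i != j) r ^+ 2.
    rewrite sumr_const -mulr_natr ler_wpM2l ?sqr_ge0// lerBlDr.
    apply: le_trans hlb _; rewrite natr1 ler_nat /overlap.
    rewrite (cardD1 i D) -[leqRHS]add1n; apply: leq_add (leq_b1 _) _.
    apply: subset_leq_card; apply/fintype.subsetP => j.
    by rewrite inE => /andP[ji jD]; apply/andP; split=> //; rewrite eq_sym.
  apply: (@le_trans _ _ (\sum_(i in C) r ^+ 2 * (y - 1))); last first.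
    by apply: ler_sum => i _; exact: inner.
  rewrite sumr_const -mulr_natr mulrCA [leRHS]mulrC ler_wpM2r//.
  by rewrite mulr_ge0 ?sqr_ge0 ?subr_ge0.
have sq0 i j : 0 <= (pi (z i) (z j) - pis (zs i) (zs j)) ^+ 2 by exact: sqr_ge0.
rewrite /discrepancy big_mkcond; apply: ler_sum => i _.
case: ifPn => [/andP[/eqP ei /eqP ei']|_]; last by apply: sumr_ge0.
rewrite big_mkcondl; apply: ler_sum => j _.
case: ifPn => [/andP[/eqP ej /eqP ej']|_]//.
by rewrite ei ei' ej ej' -(real_normK (num_real (pi a b - _))) lerXn2r.
Qed.

(** Apply [discrepancy_ge_block] to the labels f q that z uses most often on the
    true classes q: each block has at least y = c n / Q vertices, and the
    hypothesis on n gives y >= 2, whence y (y - 1) >= y^2 / 2.  The separation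
    by 2 r then makes f injective. *)
Lemma discrepancy_identifies zs z pi pis (c r : R) :
  0 < c -> 0 < r ->
  (forall q q', q != q' -> exists l,
    2 * r <= `|pis q l - pis q' l| \/ 2 * r <= `|pis l q - pis l q'|) ->
  (forall q, c * n%:R < (class_size zs q)%:R) ->
  2 * Q%:R <= c * n%:R ->
  discrepancy z pi zs pis < r ^+ 2 * (c / Q%:R) ^+ 2 / 2 * n%:R ^+ 2 ->
  exists s : 'S_Q, forall q l, `|pi (s q) (s l) - pis q l| < r.
Proof.
move=> c0 r0 sep big_class hn hd.
have [f hf] := choice (exists_majority zs z).
pose y : R := c / Q%:R * n%:R.
have [Qeq0|Qgt0] := posnP Q.
  by exists 1%g => q; have := ltn_ord q; rewrite [X in (_ < X)%N]Qeq0.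
have Q0 : 0 < Q%:R :> R by rewrite ltr0n.
have y2 : 2 <= y by rewrite /y mulrAC ler_pdivlMr.
have yf q : y <= (overlap zs z q (f q))%:R.
  rewrite /y mulrAC ler_pdivrMr // (le_trans (ltW (big_class q)))//.
  by rewrite mulrC -natrM ler_nat.
have close q l : `|pi (f q) (f l) - pis q l| < r.
  rewrite ltNge; apply/negP => hr; move: hd; apply/negP; rewrite -leNgt.
  have r0r : 0 <= r <= `|pi (f q) (f l) - pis q l| by rewrite ltW.
  have y1 : 1 <= y by lra.
  apply: le_trans (discrepancy_ge_block r0r y1 (yf q) (yf l)).
  have -> : r ^+ 2 * (c / Q%:R) ^+ 2 / 2 * n%:R ^+ 2 = r ^+ 2 * (y ^+ 2 / 2).
    by rewrite /y exprMn; ring.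
  rewrite ler_wpM2l ?sqr_ge0//; nra.
have f_inj : injective f.
  move=> q q' e; apply/eqP/negPn/negP => /sep[l [|]];
    apply/negP; rewrite -ltNge.
    have := close q l; have := close q' l; rewrite e !ltr_norml; lra.
  have := close l q; have := close l q'; rewrite e !ltr_norml; lra.
by exists (perm f_inj) => q l; rewrite !permE.
Qed.

End Identifiability.

Lemma A1_separated (R : realType) (Q : nat) (pis : 'M[R]_Q) : A1 pis ->
  exists2 r : R, 0 < r & forall q q', q != q' -> exists l,
    r <= `|pis q l - pis q' l| \/ r <= `|pis l q - pis l q'|.
Proof.
move=> hA1.
pose gap (e : ('I_Q * 'I_Q) * ('I_Q * 'I_Q)) :=
  `|pis e.1.1 e.1.2 - pis e.2.1 e.2.2|.
exists (\big[Num.min/1]_(e | gap e != 0) gap e).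
  by apply: lt_bigmin => // e; rewrite lt0r normr_ge0 andbT.
have gap_le q l q' l' : pis q l != pis q' l' ->
    \big[Num.min/1]_(e | gap e != 0) gap e <= `|pis q l - pis q' l'|.
  move=> h; rewrite -[leRHS]/(gap ((q, l), (q', l'))).
  by apply: bigmin_le_cond; rewrite /gap/= normr_eq0 subr_eq0.
move=> q q' /hA1[l [h|h]]; exists l; [left|right]; exact: gap_le.
Qed.

(** Since d0 induces the usual topology, its balls contain balls of the supremum
    norm; this turns an entrywise bound into a bound on d0. *)
Lemma usual_distance_entrywise (R : realType) (Q : nat)
    (d0 : 'M[R]_Q -> 'M[R]_Q -> R) (p : 'M[R]_Q) (eps : R) :
  usual_distance d0 -> 0 < eps ->
  exists2 r : R, 0 < r &
    forall p' : 'M[R]_Q, (forall q l, `|p' q l - p q l| < r) -> d0 p' p < eps.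
Proof.
move=> [_ _ d0C _ d0nbhs] eps0.
have /nbhs_ballP[r /= r0 hr] : nbhs p [set q | d0 p q < eps].
  by apply/d0nbhs; exists eps.
exists r => // p' hp'; rewrite d0C; apply: hr; split => // q l.
by rewrite /ball /= distrC.
Qed.

(** * Probability of a wrong estimate *)

Section ErrorEvent.
Context {R : realType} {Q n : nat}.
Implicit Types (z zs : {ffun 'I_n -> 'I_Q}) (pis : 'M[R]_Q).

Definition small_class (gamma : R) zs : bool :=
  [exists q, (class_size zs q)%:R <= gamma / 4 * n%:R].

Definition spurious_fit (c delta : R) pis zs (x : 'M[bool]_n) : Prop :=
  exists z (pi : 'M[R]_Q), [/\ forall q l, 0 <= pi q l <= 1,
    c * likelihood x zs pis <= likelihood x z pi
  & delta * n%:R ^+ 2 <= discrepancy z pi zs pis].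

Lemma sum_likelihood_loopless zs pis :
  \sum_(x : 'M[bool]_n | loopless x) likelihood x zs pis = 1.
Proof.
rewrite /likelihood.
rewrite (sum_loopless (fun i j => bernoulli_pmf (pis (zs i) (zs j)))).
by apply: big1 => i _; apply: big1 => j _; rewrite /bernoulli_pmf addrC subrK.
Qed.

(** Whether a class is small depends on the labels only, and the mass of the
    spurious fits is bounded uniformly in the labels; so the sum over the labels
    costs nothing beyond a union bound over the Q classes. *)
Lemma error_mass_le (N : nat) (alpha : 'I_Q -> R) pis (gamma eta delta c : R) :
  sbm_param alpha pis -> A3 gamma alpha ->
  0 <= eta -> N.+1%:R^-1 <= eta ^+ 2 -> 0 < c <= 1 ->
  \sum_zs prior alpha zs * \sum_(x : 'M[bool]_n | loopless x &&
     (small_class gamma zs || `[< spurious_fit c delta pis zs x >]))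
       likelihood x zs pis <=
  Q%:R * expR (- (gamma / 4)) ^+ n +
  (Q ^ n * N.+2 ^ (Q * Q))%:R *
    (c^-1 * expR ((2 * eta - delta / 4) * n%:R ^+ 2)).
Proof.
move=> [ha ha1 hpis] hA3 eta0 hN hc.
have a0 a : 0 <= alpha a by have /andP[/ltW] := ha a.
have prior0 zs : 0 <= prior alpha zs by apply: prodr_ge0 => i _; exact: a0.
have l0 zs x := likelihood_ge0 (n := n) x zs hpis.
set b := _ * (c^-1 * _).
have hb zs : \sum_(x | loopless x && `[< spurious_fit c delta pis zs x >])
    likelihood x zs pis <= b by exact: fitting_tail.
have b0 : 0 <= b.
  rewrite mulr_ge0// mulr_ge0 ?expR_ge0// invr_ge0.
  by case/andP: hc => /ltW.
apply: (@le_trans _ _ (\sum_(zs : {ffun 'I_n -> 'I_Q})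
    (\sum_q prior alpha zs * ((class_size zs q)%:R <= gamma / 4 * n%:R)%R%:R +
     prior alpha zs * b))).
  apply: ler_sum => zs _; rewrite -mulr_sumr -mulrDr ler_wpM2l//.
  have [/existsP[q hq]|hs] := boolP (small_class gamma zs); last first.
    by rewrite /=; apply: le_trans (hb zs) _; rewrite lerDr sumr_ge0.
  under eq_bigl do rewrite andbT.
  rewrite sum_likelihood_loopless (bigD1 q)//= hq -addrA lerDl addr_ge0//.
  by rewrite sumr_ge0.
rewrite big_split /= -mulr_suml (sum_prior ha1) mul1r lerD2r.
rewrite exchange_big /=.
apply: (@le_trans _ _ (\sum_(q < Q) expR (- (gamma / 4)) ^+ n)); last first.
  by rewrite sumr_const card_ord mulr_natl.
apply: ler_sum => q _; have /andP[hg _] := hA3 q.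
apply: le_trans (small_class_prior_le n a0 ha1 hg).
rewrite [leRHS]big_mkcond; apply: ler_sum => zs _.
by case: ifP => _; rewrite ?mulr1 ?mulr0.
Qed.

End ErrorEvent.

(** The number of labelings and the prior weights are exponential in n, the
    tail of the likelihood ratio is exponential in n^2. *)
Lemma expR_quadratic_tail (R : realType) (L kappa : R) (n : nat) :
  0 <= L -> L + 1 <= kappa * n%:R ->
  L ^+ n * expR (- kappa * n%:R ^+ 2) <= expR (-1) ^+ n.
Proof.
move=> L0 hn.
apply: (@le_trans _ _ (expR L ^+ n * expR (- kappa * n%:R ^+ 2))).
  rewrite ler_wpM2r ?expR_ge0// lerXn2r ?nnegrE ?expR_ge0//.
  by apply: le_trans (expR_ge1Dx _); lra.
rewrite -!expRM_natl -expRD ler_expR.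
have : 0 <= n%:R :> R by [].
nra.
Qed.

(** Deterministic part of the proof: apart from small classes, the only way for
    the estimator to be far from the truth is that a wrong parameter explains
    the graph almost as well as the true one does. *)
Lemma estimation_error_spurious (R : realType) (Q n : nat) (zeta gamma r : R)
    (alphas alpha : 'I_Q -> R) (pis pi : 'M[R]_Q) (x : 'M[bool]_n)
    (zs : {ffun 'I_n -> 'I_Q}) :
  0 < gamma <= 1 -> 0 < r ->
  (forall q q', q != q' -> exists l,
    2 * r <= `|pis q l - pis q' l| \/ 2 * r <= `|pis l q - pis l q'|) ->
  admissible zeta gamma alphas pis -> is_maximizer zeta gamma x alpha pi ->
  2 * Q%:R <= gamma / 4 * n%:R ->
  ~~ small_class gamma zs ->
  (forall s : 'S_Q, exists q l, r <= `|pi (s q) (s l) - pis q l|) ->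
  spurious_fit (gamma ^+ n) (r ^+ 2 * (gamma / 4 / Q%:R) ^+ 2 / 2) pis zs x.
Proof.
move=> /andP[g0 g1] r0 sep htrue [hadm hmax] hn hbig hfar.
have [hs _ _ hA3] := htrue; have [hm _ _ _] := hadm.
have [z hz] := likelihood_of_L2_le zs hm hs (hmax _ _ htrue).
have [_ _ hpi] := hm; have [_ _ hpis] := hs.
exists z, pi; split => //.
  apply: le_trans hz; rewrite ler_wpM2r ?likelihood_ge0//.
  rewrite -[n in gamma ^+ n]card_ord -prodr_const.
  apply: ler_prod => i _; rewrite (ltW g0)/=.
  by have /andP[] := hA3 (zs i).
rewrite leNgt; apply/negP => hd.
have [s hclose] : exists s : 'S_Q, forall q l, `|pi (s q) (s l) - pis q l| < r.
  apply: (discrepancy_identifies (c := gamma / 4) _ r0 sep _ hn hd).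
    by rewrite divr_gt0.
  by move=> q; rewrite ltNge; apply: contra hbig => h; apply/existsP; exists q.
have [q [l]] := hfar s; rewrite leNgt => /negP; apply; exact: hclose.
Qed.

(** * Consistency *)

Unset Implicit Arguments.

Theorem corollary3p7 (R : realType) (Q : nat) (zeta gamma : R)
  (d : measure_display) (T : measurableType d) (P : probability T R)
  (Z : nat -> T -> 'I_Q) (X : nat -> nat -> T -> bool)
  (alphas : 'I_Q -> R) (pis : 'M[R]_Q)
  (ahat : forall n : nat, 'M[bool]_n -> 'I_Q -> R)
  (pihat : forall n : nat, 'M[bool]_n -> 'M[R]_Q)
  (d0 : 'M[R]_Q -> 'M[R]_Q -> R)
  (hzeta : 0 < zeta) (hgamma : 0 < gamma < Q%:R^-1)
  (htrue : admissible zeta gamma alphas pis)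
  (hsbm : is_sbm P Z X alphas pis)
  (hmle : is_mle zeta gamma ahat pihat)
  (hex : maximizer_exists_whp Q P X zeta gamma)
  (hd0 : usual_distance d0) :
  cvg_in_probability P
    (fun n w => dist_upto_switch d0 (pihat n (adjacency X n w)) pis) 0.
Proof.
move=> eps eps0.
have /andP[g0 gQ] := hgamma.
have Q0 : (0 < Q)%N.
  by rewrite lt0n; apply/eqP => h; move: gQ; rewrite h invr0; lra.
have g1 : gamma <= 1.
  by rewrite (le_trans (ltW gQ))// invf_le1 ?ltr0n// ler1n.
have [hs hA1 _ hA3] := htrue.
have [r1 r10 hr1] := usual_distance_entrywise pis hd0 eps0.
have [r2 r20 hr2] := A1_separated hA1.
(* At precision r, a relabelled estimate is within eps of pis for d0, and two
   classes of pis cannot be confused. *)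
pose r := Num.min r1 (r2 / 2).
have r0 : 0 < r by rewrite lt_min r10 divr_gt0.
have rr1 : r <= r1 by rewrite ge_min lexx.
have rr2 : 2 * r <= r2.
  have : r <= r2 / 2 by rewrite ge_min lexx orbT.
  lra.
have sep q q' : q != q' -> exists l,
    2 * r <= `|pis q l - pis q' l| \/ 2 * r <= `|pis l q - pis l q'|.
  by move=> /hr2[l h]; exists l; case: h => h; [left|right]; exact: le_trans h.
pose delta := r ^+ 2 * (gamma / 4 / Q%:R) ^+ 2 / 2.
have delta0 : 0 < delta.
  by rewrite /delta !mulr_gt0 ?exprn_gt0 ?divr_gt0 ?invr_gt0 ?ltr0n.
(* Half of the exponent delta / 4 of the tail is given up to the grid. *)
pose eta := delta / 16.
have eta0 : 0 < eta by rewrite divr_gt0.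
pose N := Num.truncn (eta ^+ 2)^-1.
have hN : N.+1%:R^-1 <= eta ^+ 2.
  rewrite -[leRHS]invrK lef_pV2 ?posrE ?invr_gt0 ?exprn_gt0//.
  by rewrite ltW// truncnS_gt.
pose B n zx := small_class gamma zx.1 ||
  `[< spurious_fit (n := n) (gamma ^+ n) delta pis zx.1 zx.2 >].
pose E n := [set w | has_maximizer Q zeta gamma (adjacency X n w)].
have EE n : E n = [set w | `[< has_maximizer Q zeta gamma (adjacency X n w) >]].
  by apply/seteqP; split => w /= /asboolP.
have mE n : measurable (E n).
  rewrite EE.
  apply: (@measurable_finite_valued _ _ _ (adjacency X n)
    (measurable_adjacency hsbm (n := n)) (fun x => `[< _ x >])).
pose bound n : R := Q%:R * expR (- (gamma / 4)) ^+ n +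
  (N.+2 ^ (Q * Q))%:R * expR (-1) ^+ n.
pose kappa := delta / 8.
have kappa0 : 0 < kappa by rewrite divr_gt0.
have PB : \forall n \near \oo,
    (P [set w | B n (sample Z X n w)] <= (bound n)%:E)%E.
  near=> n.
  rewrite (sample_law hsbm) lee_fin.
  have gn : 0 < gamma ^+ n <= 1 by rewrite exprn_gt0//= exprn_ile1// ltW.
  apply: (le_trans (error_mass_le delta hs hA3 (ltW eta0) hN gn)).
  rewrite lerD2l natrM -mulrA mulrCA ler_wpM2l//.
  have -> : (Q ^ n)%:R * ((gamma ^+ n)^-1 *
      expR ((2 * eta - delta / 4) * n%:R ^+ 2)) =
      (Q%:R / gamma) ^+ n * expR (- kappa * n%:R ^+ 2).
    have -> : 2 * eta - delta / 4 = - kappa.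
      by rewrite /eta /kappa; lra.
    by rewrite natrX mulrA expr_div_n.
  apply: expR_quadratic_tail; first by rewrite divr_ge0// ltW.
  rewrite [leRHS]mulrC -ler_pdivrMr//.
  by near: n; exact: nbhs_infty_ger.
(* An error requires that no maximizer exists, that a true class is small, or
   that a spurious fit occurs. *)
have cover : \forall n \near \oo,
    [set w | eps <= `|dist_upto_switch d0 (pihat n (adjacency X n w)) pis - 0|]
    `<=` ~` E n `|` [set w | B n (sample Z X n w)].
  near=> n => w /= hw.
  have [Ew|] := pselect (E n w); [right|by left].
  rewrite /B /=; have [//|hbig] := boolP (small_class _ _).
  apply/asboolP.
  have hn : 2 * Q%:R <= gamma / 4 * n%:R.
    rewrite [leRHS]mulrC -ler_pdivrMr ?divr_gt0//.
    by near: n; exact: nbhs_infty_ger.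
  have g01 : 0 < gamma <= 1 by rewrite g0.
  have hm := hmle _ _ Ew.
  apply: (estimation_error_spurious g01 r0 sep htrue hm hn hbig).
  move=> s; apply: contrapT => hclose.
  move: hw; apply/negP; rewrite -ltNge subr0 ger0_norm; last first.
    by have [d00 _ _ _ _] := hd0; apply: le_bigmin => // s' _; exact: d00.
  apply: le_lt_trans (bigmin_le _ s _) _.
  apply: hr1 => q l; rewrite mxE ltNge; apply/negP => h; apply: hclose.
  by exists q, l; exact: le_trans h.
have adjE n : measurable
    [set w | eps <= `|dist_upto_switch d0 (pihat n (adjacency X n w)) pis - 0|].
  exact: (@measurable_finite_valued _ _ _ (adjacency X n)
    (measurable_adjacency hsbm (n := n))
    (fun x => eps <= `|dist_upto_switch d0 (pihat n x) pis - 0|)).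
have mB n : measurable [set w | B n (sample Z X n w)].
  exact: (@measurable_finite_valued _ _ _ (sample Z X n)
    (measurable_sample hsbm (n := n)) (B n)).
apply: (@squeeze_cvge _ _ _ _ (cst 0%E) _
    (fun n => (1 - P (E n)) + (bound n)%:E)%E).
- near=> n; rewrite measure_ge0/=.
  have mEC : measurable (~` E n) by exact: measurableC.
  apply: (@le_trans _ _ (P (~` E n `|` [set w | B n (sample Z X n w)]))).
    apply: le_measure; rewrite ?inE//; first exact: measurableU.
    by near: n.
  rewrite -(probability_setC P (mE n)).
  apply: le_trans (measureU2 P mEC (mB n)) _; apply: leeD => //.
  by near: n.
- exact: cvg_cst.
- rewrite -[X in _ --> X]adde0; apply: cvgeD => //.
    rewrite -(subee (x := 1%E))//; apply: cvgeB => //; exact: cvg_cst.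
  apply: cvg_EFin; first by near=> n.
  rewrite -[X in _ --> X]addr0; apply: cvgD.
    apply: cvg_geometric; rewrite ger0_norm ?expR_ge0// expR_lt1; lra.
  apply: cvg_geometric; rewrite ger0_norm ?expR_ge0// expR_lt1; lra.
Unshelve. all: by end_near.
Qed.
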